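(* Let $k \in \mathbb{Z}$ and $n,m\in\mathbb{Z}^+$ with $n\geq 2$, $k\not\equiv 0\pmod n$, and $m\geq 2$, and let $K_m$ be the complete graph on $m$ vertices. Then $\chi_{(n,k)}(K_m) = m$ if $(m-1,n)\mid k$, and $\chi_{(n,k)}(K_m)$ does not exist otherwise.
   Context: $(a,b)$ denotes the greatest common divisor. For a graph $G=(V,E)$, a $\mathbb{Z}$-labeling is a map $\ell:V\to\mathbb{Z}$; its order is the size of its range; it is proper if adjacent vertices get different labels. $N(v)$ is the open neighborhood of $v$. An open coloring with remainder $k \bmod n$ is a labeling with $\sum_{w\in N(v)}\ell(w)\equiv k \pmod n$ for all $v\in V$. If no proper such coloring exists, $\chi_{(n,k)}(G)$ does not exist; otherwise $\chi_{(n,k)}(G)$ is the minimum order of a proper open coloring with remainder $k\bmod n$. *)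

(* Defs.v *)
From mathcomp Require Import all_boot all_order all_algebra.
From mathcomp Require Import boolp.

Set Implicit Arguments.
Unset Strict Implicit.
Unset Printing Implicit Defensive.

Import GRing.Theory.
Local Open Scope ring_scope.

Record sgraph := SGraph {
  vertex :> finType;
  adj : rel vertex;
  adj_sym : symmetric adj;
  adj_irrefl : irreflexive adj
}.

Definition open_nbhd (G : sgraph) (v : G) : {set G} := [set w | adj v w].

Definition labeling (G : sgraph) := G -> int.

Definition order_of (G : sgraph) (l : labeling G) : nat :=
  size (undup (codom l)).

Definition proper_labeling (G : sgraph) (l : labeling G) : Prop :=
  forall v w : G, adj v w -> l v <> l w.

Definition open_coloring (n : nat) (k : int) (G : sgraph) (l : labeling G) :
    Prop :=
  forall v : G, (\sum_(w in open_nbhd v) l w = k %[mod n])%Z.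

Definition proper_open_coloring (n : nat) (k : int) (G : sgraph)
    (l : labeling G) : Prop :=
  proper_labeling l /\ open_coloring n k l.

Definition attained_order (n : nat) (k : int) (G : sgraph) : pred nat :=
  fun r => `[< exists l : labeling G,
                 proper_open_coloring n k l /\ order_of l = r >].

(* [None] stands for "does not exist". The choice is classical ([pselect]) because
   labelings range over infinitely many maps into [int]. *)
Definition open_chromatic_number (n : nat) (k : int) (G : sgraph) :
    option nat :=
  if pselect (exists r, attained_order n k G r) is left ex
  then Some (ex_minn ex) else None.

Definition complete_adj (m : nat) : rel 'I_m := fun i j => i != j.

Lemma complete_adj_sym (m : nat) : symmetric (@complete_adj m).
Proof. by move=> i j; rewrite /complete_adj eq_sym. Qed.

Lemma complete_adj_irrefl (m : nat) : irreflexive (@complete_adj m).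
Proof. by move=> i; rewrite /complete_adj eqxx. Qed.

Definition complete_graph (m : nat) : sgraph :=
  SGraph (@complete_adj_sym m) (@complete_adj_irrefl m).

(* Main.v *)
Require Import Defs.
From mathcomp Require Import all_boot all_order all_algebra.
From mathcomp Require Import boolp ring.

Set Implicit Arguments.
Unset Strict Implicit.
Unset Printing Implicit Defensive.

Import GRing.Theory.
Local Open Scope ring_scope.

(* Writing S for the sum of all labels, the condition at v reads S - l v = k
   mod n, so all labels are congruent to a = S - k, and the condition becomes
   (m - 1) a = k mod n, which is solvable iff gcd (m - 1, n) divides k. Given
   a solution a, the labels a + n i are pairwise distinct; and a proper
   labeling of a complete graph always uses m labels. *)

Lemma mem_open_nbhd_complete (m : nat) (v w : complete_graph m) :
  (w \in open_nbhd v) = (w != v).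
Proof. by rewrite inE eq_sym. Qed.

Lemma card_open_nbhd_complete (m : nat) (v : complete_graph m) :
  #|open_nbhd v| = (m - 1)%N.
Proof.
rewrite (eq_card (B := predC1 v)); last first.
  by move=> w; rewrite mem_open_nbhd_complete.
by rewrite cardC1 card_ord subn1.
Qed.

Lemma sum_open_nbhd_complete (m : nat) (l : labeling (complete_graph m)) v :
  \sum_(w in open_nbhd v) l w = \sum_w l w - l v.
Proof.
rewrite [in RHS](bigD1 v) //= addrAC subrr add0r.
by apply: eq_bigl => w; rewrite mem_open_nbhd_complete.
Qed.

(** Distinct vertices are adjacent, so properness is injectivity. *)
Lemma order_of_proper_complete (m : nat) (l : labeling (complete_graph m)) :
  proper_labeling l -> order_of l = m.
Proof.
move=> lP; have l_inj : injective l.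
  by move=> v w lvw; apply/eqP/negPn/negP => /lP.
by rewrite /order_of undup_id ?size_codom ?card_ord //; apply/injectiveP.
Qed.

Lemma open_coloring_complete_dvd (n m : nat) (k : int)
    (l : labeling (complete_graph m)) :
  (0 < m)%N -> open_coloring n k l -> (gcdn (m - 1) n %| k)%Z.
Proof.
move=> m_gt0 lP; set S := \sum_w l w.
have g_n : ((gcdn (m - 1) n)%:Z %| n%:Z)%Z by exact: dvdn_gcdr.
have sum_k v : (n %| \sum_(w in open_nbhd v) l w - k)%Z.
  by rewrite -eqz_mod_dvd; apply/eqP/lP.
have lE v : (n %| l v - (S - k))%Z.
  rewrite -rpredN; have := sum_k v; rewrite sum_open_nbhd_complete -/S.
  by congr (_ %| _)%Z; ring.
pose v : complete_graph m := Ordinal m_gt0.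
(* [k] is the neighborhood sum minus a multiple of [n], so it suffices that the gcd divides that
   sum. *)
rewrite -[k](subKr (\sum_(w in open_nbhd v) l w)) rpredB //; last first.
  exact: dvdz_trans (sum_k v).
(* Each label splits as a multiple of [n] plus [S - k]; the [m - 1] copies of [S - k] add up to a
   multiple of [m - 1]. *)
under eq_bigr => w _ do rewrite -(subrK (S - k) (l w)).
rewrite big_split /= rpredD //.
  by apply: rpred_sum => w _; exact: dvdz_trans (lE w).
rewrite sumr_const card_open_nbhd_complete -mulr_natl dvdz_mulr // natz.
exact: dvdn_gcdl.
Qed.

Lemma proper_open_coloring_complete_exists (n m : nat) (k : int) :
  (0 < n)%N -> (gcdn (m - 1) n %| k)%Z ->
  exists l : labeling (complete_graph m), proper_open_coloring n k l.
Proof.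
move=> n_gt0 /dvdzP[q ->]; have [u [v uvE]] := Bezoutz (m - 1)%N n.
(* Since [u * (m - 1)] is the gcd modulo [n], the residue [q * u] solves the congruence. *)
exists (fun i : 'I_m => q * u + n%:Z * (i : nat)%:Z); split.
  have n_neq0 : n%:Z != 0 by rewrite eqz_nat -lt0n.
  move=> i j ij /addrI/(mulfI n_neq0)[/val_inj eq_ij].
  by rewrite eq_ij adj_irrefl in ij.
move=> i; apply/eqP; rewrite eqz_mod_dvd big_split /= sumr_const.
rewrite card_open_nbhd_complete -mulr_natl natz -mulr_sumr.
have -> : (gcdn (m - 1) n)%:Z = u * (m - 1)%N%:Z + v * n%:Z by rewrite uvE.
(* [T] sums the neighboring indices; [- q * v] comes from the Bezout term [v * n]. *)
set T := \sum_(_ in _) _; apply/dvdzP; exists (T - q * v); ring.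
Qed.

Theorem theorem6p3 (k : int) (n m : nat) (hn : (2 <= n)%N)
    (hk : (k <> 0 %[mod n])%Z) (hm : (2 <= m)%N) :
  ((gcdn (m - 1) n %| k)%Z ->
     open_chromatic_number n k (complete_graph m) = Some m) /\
  (~~ (gcdn (m - 1) n %| k)%Z ->
     open_chromatic_number n k (complete_graph m) = None).
Proof.
rewrite /open_chromatic_number; case: pselect => [ex | no_col]; split.
(* Every attained order is [m], hence so is the least one. *)
- move=> _; case: ex_minnP => r /asboolP[l [[l_proper _] <-]] _.
  by rewrite order_of_proper_complete.
- case: ex => r /asboolP[l [[_ l_open] _]] /negP[].
  exact: open_coloring_complete_dvd (ltnW hm) l_open.
- move=> /(proper_open_coloring_complete_exists (ltnW hn))[l lP].
  by case: no_col; exists (order_of l); apply/asboolP; exists l.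
- by [].
Qed.
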